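(* Let $f\in\mathbb{C}[x_0,\ldots,x_n]_d$ be a $k$-concise homogeneous form with $2k\le d$, and let $l,s$ be integers such that $l\le k\le s$ and $s+l\le d$. Let $I=\operatorname{Ann}(f)$ and $A=Q/I$, and suppose that $\operatorname{Hilb}(A)$ is unimodal. Suppose that $\operatorname{Hess}_f^{(l,s)}$ is degenerate, or equivalently, that for a generic $L\in A_1$ the map $\bullet L^{d-s-l}:A_l\to A_{d-s}$ is not injective. Then $$cr(f)>\binom{n+k}{k}.$$ In particular, if $\underline{rk}(f)\le a_k$, then $f$ is wild.
   Context: $Q=\mathbb{C}[X_0,\ldots,X_n]$ acts on $R=\mathbb{C}[x_0,\ldots,x_n]$ by $X_i=\partial/\partial x_i$; $\operatorname{Ann}(f)=\{\alpha\in Q:\alpha(f)=0\}$, $A=\bigoplus_{i=0}^d A_i$, $a_i=\dim A_i$. $\operatorname{Hilb}(A)=(a_0,\ldots,a_d)$ is unimodal if there is $j$ with $a_0\le a_1\le\cdots\le a_j\ge a_{j+1}\ge\cdots\ge a_d$. A form $f\in R_d$, with $d\ge 2k+1$, is $k$-concise if $I_j=0$ for $j=1,\ldots,k$; equivalently $a_j=\binom{n+j}{j}$ for $j=0,\ldots,k$. Given bases $(\alpha_i)$ of $A_l$ and $(\beta_j)$ of $A_s$, $\operatorname{Hess}_f^{(l,s)}=[\alpha_i\beta_j(f)]$, a matrix with entries in $R$; it is degenerate if it does not have maximal rank. Let $\mathcal{V}_d(\mathbb{P}^n)=\{[\ell^d]:\ell\in R_1\setminus\{0\}\}\subset\mathbb{P}(R_d)$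 be the Veronese variety. The border rank $\underline{rk}(f)$ is the least $r$ such that $[f]$ lies in the $r$-th secant variety of $\mathcal{V}_d(\mathbb{P}^n)$ (the closure of the union of the spans of $r$ of its points). The cactus rank $cr(f)$ (respectively smoothable rank $sr(f)$) is the least $r$ such that there is a finite scheme (respectively a smoothable finite scheme) $K\subset\mathcal{V}_d(\mathbb{P}^n)$ of length $r$ with $[f]\in\langle K\rangle$. The form $f$ is wild if $\underline{rk}(f)<sr(f)$. *)

(* Defs.v *)
From HB Require Import structures.
From mathcomp Require Import all_boot all_order all_algebra.
(* mpoly has to be imported before the MathComp-Analysis files: the other order
   is rejected because of incompatible notation levels. *)
From mathcomp Require Import complex mpoly.
From mathcomp Require Import boolp classical_sets reals ereal.

Set Implicit Arguments.
Unset Strict Implicit.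
Unset Printing Implicit Defensive.

Import Order.TTheory GRing.Theory Num.Theory.

Local Open Scope classical_set_scope.
Local Open Scope ring_scope.

(* The field of complex numbers is R[i] for R : realType. The ring of differential
   operators with constant coefficients and the ring it acts on are both
   {mpoly R[i][n]}; 'X_i acts as the i-th partial derivative. *)

Section Apolarity.
Variables (R : realType) (n : nat).
Local Notation C := R[i].
Local Notation poly := {mpoly C[n]}.

Definition diffop (alpha f : poly) : poly :=
  \sum_(m <- msupp alpha) alpha@_m *: f^`M[m].

Definition Ann (f : poly) : set poly := [set alpha | diffop alpha f = 0].

(* b consists of forms of degree e whose classes are a basis of the degree e
   part of the quotient of the polynomial ring by J (J a homogeneous ideal). *)
Definition quot_basis (J : set poly) (e r : nat) (b : r.-tuple poly) : Prop :=
  [/\ forall i, tnth b i \is e.-homog,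
      forall p, p \is e.-homog ->
        exists c : 'I_r -> C, J (p - \sum_i c i *: tnth b i)
    & forall c : 'I_r -> C,
        J (\sum_i c i *: tnth b i) -> forall i, c i = 0].

Definition quot_dim (J : set poly) (e : nat) : nat :=
  xget 0%N [set r | exists b : r.-tuple poly, quot_basis J e b].

Definition hilb (f : poly) (j : nat) : nat := quot_dim (Ann f) j.

Definition k_concise (k : nat) (f : poly) : Prop :=
  forall j, (1 <= j <= k)%N ->
    forall alpha, alpha \is j.-homog -> Ann f alpha -> alpha = 0.

Definition hess (f : poly) (p q : nat) (alpha : p.-tuple poly)
    (beta : q.-tuple poly) : 'M[poly]_(p, q) :=
  \matrix_(i, j) diffop (tnth alpha i * tnth beta j) f.

Definition degenerate (p q : nat) (M : 'M[poly]_(p, q)) : Prop :=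
  (\rank (map_mx (@tofrac poly) M) < minn p q)%N.

Definition linear_form (a : 'I_n -> C) : poly := \sum_i a i *: 'X_i.

(* Injectivity of the map A_l -> A_(l + m) induced by multiplication by L ^+ m,
   for A the quotient by Ann f. *)
Definition mul_pow_injective (f L : poly) (l m : nat) : Prop :=
  forall u v, u \is l.-homog -> v \is l.-homog ->
    Ann f (L ^+ m * u - L ^+ m * v) -> Ann f (u - v).

(* P holds on a nonempty (principal) Zariski open subset of C^n. *)
Definition generically (P : ('I_n -> C) -> Prop) : Prop :=
  exists2 g : poly, g != 0 & forall a, g.@[a] != 0 -> P a.

End Apolarity.

Definition unimodal (d : nat) (a : nat -> nat) : Prop :=
  exists2 j, (j <= d)%N &
    (forall i, (i < j)%N -> (a i <= a i.+1)%N) /\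
    (forall i, (j <= i < d)%N -> (a i.+1 <= a i)%N).

Section Coordinates.
Variable m : nat.

Definition monomials (e : nat) : seq 'X_{1..m} :=
  [seq bmnm x | x <- enum {: 'X_{1..m < e.+1}} & mdeg (bmnm x) == e].

Definition ncoord (e : nat) : nat := size (monomials e).

Definition coefv (F : fieldType) (e : nat) (p : {mpoly F[m]}) :
    'rV[F]_(ncoord e) :=
  \row_i p@_(nth 0%MM (monomials e) i).

End Coordinates.

Section ProjectiveSchemes.
Variable R : realType.
Local Notation C := R[i].

Definition zariski_closure (m : nat) (X : set 'rV[C]_m) : set 'rV[C]_m :=
  [set v | forall P : {mpoly C[m]},
     (forall u, X u -> P.@[u 0] = 0) -> P.@[v 0] = 0].

(* Closed subschemes of the projective space with homogeneous coordinate ring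
   {mpoly C[m]} correspond to saturated homogeneous ideals. *)
Record saturated_hom_ideal (m : nat) (J : set {mpoly C[m]}) : Prop := {
  shi_0 : J 0;
  shi_add : forall p q, J p -> J q -> J (p + q);
  shi_mul : forall p q, J q -> J (p * q);
  shi_homog : forall e p, J p -> J (pihomog mdeg e p);
  shi_sat : forall e p, (forall q, q \is e.-homog -> J (q * p)) -> J p }.

(* The length of a finite scheme is its (constant) Hilbert polynomial; a scheme
   with constant Hilbert polynomial is finite. *)
Definition finite_scheme (m r : nat) (J : set {mpoly C[m]}) : Prop :=
  saturated_hom_ideal J /\
  exists e0, forall e, (e0 <= e)%N -> quot_dim J e = r.

(* The degree e part of J is the kernel of the linear map of rank r with
   matrix M, i.e., M represents the point J_e of the Grassmannian of subspaces
   of codimension r of the space of forms of degree e. *)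
Definition presents (m e r : nat) (J : set {mpoly C[m]})
    (M : 'M[C]_(ncoord m e, r)) : Prop :=
  \rank M = r /\ forall p, p \is e.-homog -> (J p <-> coefv e p *m M = 0).

Definition points_ideal (m r : nat) (G : 'I_r -> 'rV[C]_m) :
    set {mpoly C[m]} :=
  [set p | forall i, p.@[G i 0] = 0].

(* The G i are representatives of r distinct points of a projective space. *)
Definition distinct_points (m r : nat) (G : 'I_r -> 'rV[C]_m) : Prop :=
  (forall i, G i != 0) /\
  (forall i j, i != j -> forall c : C, G i != c *: G j).

(* For e large, J |-> J_e embeds the Hilbert scheme of length r subschemes as a
   closed subset of the Grassmannian above. J is smoothable if it lies in the
   closure of the locus of smooth subschemes (r distinct points). That locus is
   described by all matrices presenting its members: this set is stable under
   the action of GL_r, so its closure among matrices of rank r is the preimage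
   of the closure in the Grassmannian. *)
Definition smoothable (m r : nat) (J : set {mpoly C[m]}) : Prop :=
  exists e0, forall e, (e0 <= e)%N ->
    exists2 M : 'M[C]_(ncoord m e, r), presents J M &
      zariski_closure
        [set v | exists2 G : 'I_r -> 'rV[C]_m, distinct_points G &
           exists2 M' : 'M[C]_(ncoord m e, r),
             presents (points_ideal G) M' & v = mxvec M']
        (mxvec M).

End ProjectiveSchemes.

Section Ranks.
Variables (R : realType) (n d : nat).
Local Notation C := R[i].
Local Notation poly := {mpoly C[n]}.

(* A point [g] of P(R_d) has homogeneous coordinates [coefv d g], and P(R_d) has
   homogeneous coordinate ring {mpoly C[ncoord n d]}. *)
Local Notation coord_ring := {mpoly C[ncoord n d]}.

Definition veronese : set 'rV[C]_(ncoord n d) :=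
  [set v | exists2 ell : poly, ell \is 1.-homog /\ ell != 0 &
     v = coefv d (ell ^+ d)].

Definition subscheme_of_veronese (J : set coord_ring) : Prop :=
  forall e (P : coord_ring), P \is e.-homog ->
    (forall v, veronese v -> P.@[v 0] = 0) -> J P.

(* The span of a subscheme is the intersection of the hyperplanes containing
   it. *)
Definition in_span (J : set coord_ring) (f : poly) : Prop :=
  forall H : coord_ring, H \is 1.-homog -> J H -> H.@[coefv d f 0] = 0.

(* The affine cone over the union of the spans of r points of the Veronese
   variety; being a cone, its closure is the cone over the secant variety. *)
Definition secant_cone (r : nat) : set 'rV[C]_(ncoord n d) :=
  [set v | exists2 w : 'I_r -> 'rV[C]_(ncoord n d), forall i, veronese (w i) &
     exists c : 'I_r -> C, v = \sum_i c i *: w i].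

(* The least element of a set of natural numbers (+oo if it is empty). *)
Definition least (X : set nat) : \bar R :=
  ereal_inf [set (r%:R)%:E | r in X].

Definition border_rank (f : poly) : \bar R :=
  least [set r | zariski_closure (secant_cone r) (coefv d f)].

Definition cactus_rank (f : poly) : \bar R :=
  least [set r | exists J : set coord_ring,
    [/\ finite_scheme r J, subscheme_of_veronese J & in_span J f]].

Definition smoothable_rank (f : poly) : \bar R :=
  least [set r | exists J : set coord_ring,
    [/\ finite_scheme r J, smoothable r J, subscheme_of_veronese J
      & in_span J f]].

Definition wild (f : poly) : Prop := (border_rank f < smoothable_rank f)%E.

End Ranks.

(* Main.v *)
(* Degeneracy of the Hessian is a polynomial family [u(a)] in [A_l], not zero,
   with [L_a ^+ (d - s - l) * u(a) = 0] in [A_(d - s)] for all linear forms [L_a].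

   Let [Z] be a scheme of length [r <= 'C(n + k, k) = a_k] whose span contains
   [f], and let [I] be its saturated ideal; then [I] is contained in [Ann f] up to
   degree [d]. The generic linear form is regular modulo the saturated ideal [I],
   even on polynomial families. Hence the Hilbert function of [I] is bounded by
   its value [r] in large degrees. Symmetry and unimodality give [a_e >= a_k >= r]
   for [k <= e <= d - k], so [I] and [Ann f] agree in these degrees. If
   [k <= d - s], then [L_a ^+ (d - s - l) * u(a)] lies in [I] and regularity puts
   [u(a)] in [I], hence in [Ann f], a contradiction. If [d - s < k], then
   [Ann f] vanishes in degree [d - s] by conciseness, and the same argument
   applies. *)

Require Import Defs.
From HB Require Import structures.
From mathcomp Require Import all_boot all_order all_algebra.
From mathcomp Require Import complex mpoly.
From mathcomp Require ssrcomplements.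
From mathcomp Require Import boolp classical_sets reals ereal.

Set Implicit Arguments.
Unset Strict Implicit.
Unset Printing Implicit Defensive.

Import Order.TTheory GRing.Theory Num.Theory.

Local Open Scope ring_scope.

(** * Polynomial matrices and polynomial functions *)

Section FractionMatrices.
Variable A : idomainType.
Implicit Types p q : nat.

Lemma fraction_denominator (x : {fraction A}) :
  exists2 D : A, D != 0 & exists y : A, tofrac D * x = tofrac y.
Proof.
elim/quotW: x => x; exists (frac x).2; first exact: denom_ratioP.
exists (frac x).1.
rewrite -[in LHS](Ratio_numden x); set u := (frac x).1; set w := (frac x).2.
have w0 : w != 0 by exact: denom_ratioP.
unlock FracField.tofrac; rewrite !piE; apply/eqmodP => /=.
rewrite /FracField.equivf /FracField.mulf !numden_Ratio ?mul1r ?oner_neq0 //.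
by rewrite mulr1.
Qed.

Lemma fraction_mx_denominator p q (X : 'M[{fraction A}]_(p, q)) :
  exists2 D : A, D != 0 &
    exists Y : 'M[A]_(p, q), tofrac D *: X = map_mx (@tofrac A) Y.
Proof.
have /choice [g hg] : forall ij : 'I_p * 'I_q,
    exists Dy : A * A, Dy.1 != 0 /\ tofrac Dy.1 * X ij.1 ij.2 = tofrac Dy.2.
  move=> [i j] /=; have [D D0 [y hy]] := fraction_denominator (X i j).
  by exists (D, y).
exists (\prod_ij (g ij).1); first by apply/prodf_neq0 => ij _; case: (hg ij).
exists (\matrix_(i, j) (\prod_(ij | ij != (i, j)) (g ij).1 * (g (i, j)).2)).
apply/matrixP => i j; rewrite !mxE (bigD1 (i, j)) //= !rmorphM /=.
by have [_ /= <-] := hg (i, j); rewrite mulrA; congr (_ * _); exact: mulrC.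
Qed.

Lemma map_tofrac_inj p q :
  injective (map_mx (@tofrac A) : 'M_(p, q) -> 'M_(p, q)).
Proof.
move=> X Y /matrixP XY; apply/matrixP => i j.
by have /eqP := XY i j; rewrite !mxE tofrac_eq => /eqP.
Qed.

(** Clearing denominators in a kernel vector over the fraction field keeps it nonzero, so rank
    deficiency becomes a relation between the rows with coefficients in [A]. *)
Lemma fraction_mx_kernel p q (M : 'M[A]_(p, q)) :
  (\rank (map_mx (@tofrac A) M) < p)%N ->
  exists2 v : 'rV[A]_p, v != 0 & v *m M = 0.
Proof.
set MF := map_mx _ M => rk.
have /rowV0Pn [x /sub_kermxP xM x0] : kermx MF != 0.
  by rewrite -mxrank_eq0 mxrank_ker subn_eq0 -ltnNge.
have [D D0 [v hv]] := fraction_mx_denominator x.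
exists v.
  apply: contraNneq x0 => v0; move: hv; rewrite v0 map_mx0 => /eqP.
  by rewrite scalemx_eq0 tofrac_eq0 (negbTE D0).
apply: map_tofrac_inj.
by rewrite map_mxM /= -hv -scalemxAl xM scaler0 map_mx0.
Qed.

(** Full row rank gives a right inverse over the fraction field. Once denominators are cleared, [D]
    controls specialization: where it is nonzero, full row rank persists. *)
Lemma fraction_mx_right_inverse p q (M : 'M[A]_(p, q)) :
  ~ (\rank (map_mx (@tofrac A) M) < p)%N ->
  exists2 D : A, D != 0 & exists W : 'M[A]_(q, p), M *m W = D%:M.
Proof.
set MF := map_mx _ M => /negP; rewrite -leqNgt => rk.
have /mulmxVp MV : row_free MF by rewrite /row_free eqn_leq rank_leq_row.
have [D D0 [W hW]] := fraction_mx_denominator (pinvmx MF).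
exists D => //; exists W.
apply: map_tofrac_inj.
by rewrite map_mxM /= -hW -scalemxAr MV map_scalar_mx scalemx1.
Qed.

End FractionMatrices.

(** * Polynomials that vanish at every point *)

Section Kronecker.
Variables (F : numFieldType) (n : nat).

(** The lowest digit is the residue modulo [B]; removing it and dividing by [B] leaves one digit
    fewer. *)
Lemma digits_inj (B k : nat) (u v : 'I_k -> nat) :
  (forall i, u i < B)%N -> (forall i, v i < B)%N ->
  (\sum_i u i * B ^ i = \sum_i v i * B ^ i)%N -> u =1 v.
Proof.
elim: k u v => [|k IH] u v hu hv; first by move=> _ [].
have B0 : (0 < B)%N by apply: leq_ltn_trans (hu ord0).
rewrite !big_ord_recl !muln1.
have shift (w : 'I_k.+1 -> nat) :
    (\sum_(i < k) w (lift ord0 i) * B ^ bump 0 i =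
      (\sum_(i < k) w (lift ord0 i) * B ^ i) * B)%N.
  by rewrite big_distrl; apply: eq_bigr => i _; rewrite /bump expnS mulnA mulnAC.
rewrite !shift => e i.
have e0 : u ord0 = v ord0.
  by move: (congr1 (modn^~ B) e); rewrite /= ![(_ + _ * B)%N]addnC !modnMDl !modn_small.
have es : (\sum_(i < k) u (lift ord0 i) * B ^ i =
           \sum_(i < k) v (lift ord0 i) * B ^ i)%N.
  by move/eqP: e; rewrite e0 eqn_add2l eqn_pmul2r // => /eqP.
case: (unliftP ord0 i) => [j ->|-> //].
by apply: (IH (fun j => u (lift ord0 j)) (fun j => v (lift ord0 j))).
Qed.

Lemma poly_eq0_of_horner (P : {poly F}) : (forall x, P.[x] = 0) -> P = 0.
Proof.
move=> P0; apply/eqP/negPn/negP => nz.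
(* These are [size P] distinct roots in characteristic zero, more than the degree allows. *)
have := max_poly_roots (rs := [seq i%:R | i <- iota 0 (size P)]) nz.
rewrite size_map size_iota ltnn => h; apply/notF/h.
  by apply/allP => x _; apply/rootP.
rewrite map_inj_uniq ?iota_uniq // => i j /eqP.
by rewrite eqr_nat => /eqP.
Qed.

(* Kronecker substitution ['X_i |-> 'X ^ (B ^ i)], injective on the support of
   [p] when [B] bounds the degrees. *)
Lemma mpoly_eq0_of_meval (p : {mpoly F[n]}) : (forall a, p.@[a] = 0) -> p = 0.
Proof.
move=> p0; pose B := msize p.
pose w (m : 'X_{1..n}) := (\sum_i m i * B ^ i)%N.
pose P : {poly F} := \sum_(m <- msupp p) p@_m *: 'X^(w m).
have P0 : P = 0.
  apply: poly_eq0_of_horner => x; rewrite -(p0 (fun i => x ^+ (B ^ i))) mevalE.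
  rewrite /P horner_sum; apply: eq_bigr => m _; rewrite hornerZ hornerXn.
  rewrite -prodrXr; congr (_ * _); apply: eq_bigr => i _.
  by rewrite -exprM mulnC.
apply/mpolyP => m; rewrite mcoeff0; case: (boolP (m \in msupp p)); last first.
  exact: memN_msupp_eq0.
move=> mp; have /(congr1 (fun P : {poly F} => P`_(w m))) := P0.
have hB (m' : 'X_{1..n}) : m' \in msupp p -> forall i, (m' i < B)%N.
  move=> /msize_mdeg_lt; rewrite mdegE => h i; apply: leq_ltn_trans h.
  by rewrite (bigD1 i) //= leq_addr.
rewrite coef0 coef_sum (bigD1_seq m) ?msupp_uniq //= coefZ coefXn eqxx mulr1.
rewrite big_seq_cond big1 ?addr0 // => m' /andP[m'p m'm].
rewrite coefZ coefXn; case: eqP; rewrite ?mulr0 // => e.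
case/negP: m'm; apply/eqP/esym/mnmP; apply: digits_inj e; exact: hB.
Qed.

End Kronecker.

(** * Differential operators *)

Section DiffOp.
Variables (R : realType) (n : nat).
Local Notation C := R[i].
Local Notation poly := {mpoly C[n]}.
Implicit Types (f g u v : poly) (c : C) (m : 'X_{1..n}).

(** A summation range independent of the support of [u] makes linearity in [u] a termwise matter. *)
Lemma diffopwE k u f : (msize u <= k)%N ->
  diffop u f = \sum_(m : 'X_{1..n < k}) u@_m *: f^`M[m].
Proof.
move=> uk; pose I : subFinType _ := 'X_{1..n < k}.
rewrite /diffop (ssrcomplements.big_mksub I) //=; first last.
- by move=> m /msize_mdeg_lt /leq_trans; apply.
- by rewrite msupp_uniq.
by rewrite big_rmcond //= => m /memN_msupp_eq0 ->; rewrite scale0r.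
Qed.

Lemma diffopDl f u v : diffop (u + v) f = diffop u f + diffop v f.
Proof.
pose k := maxn (msize u) (msize v).
rewrite !(@diffopwE k) ?leq_maxl ?leq_maxr ?msizeD_le // -big_split /=.
by apply: eq_bigr => m _; rewrite mcoeffD scalerDl.
Qed.

Lemma diffopZl f c u : diffop (c *: u) f = c *: diffop u f.
Proof.
rewrite !(@diffopwE (msize u)) ?msizeZ_le // scaler_sumr.
by apply: eq_bigr => m _; rewrite mcoeffZ scalerA.
Qed.

Lemma diffop0l f : diffop 0 f = 0.
Proof. by have := diffopZl f 0 0; rewrite !scale0r. Qed.

Lemma diffopBl f u v : diffop (u - v) f = diffop u f - diffop v f.
Proof. by rewrite diffopDl -scaleN1r diffopZl scaleN1r. Qed.

Lemma diffop_suml (I : Type) (r : seq I) (P : pred I) (F : I -> poly) f :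
  diffop (\sum_(i <- r | P i) F i) f = \sum_(i <- r | P i) diffop (F i) f.
Proof.
exact: (big_morph (fun u => diffop u f) (diffopDl f) (diffop0l f)).
Qed.

Lemma diffopDr u f g : diffop u (f + g) = diffop u f + diffop u g.
Proof.
rewrite /diffop -big_split /=; apply: eq_bigr => m _.
by rewrite mderivmD scalerDr.
Qed.

Lemma diffopZr u c f : diffop u (c *: f) = c *: diffop u f.
Proof.
rewrite /diffop scaler_sumr; apply: eq_bigr => m _.
by rewrite mderivmZ !scalerA mulrC.
Qed.

Lemma diffop0r u : diffop u 0 = 0.
Proof. by have := diffopZr u 0 0; rewrite !scale0r. Qed.

Lemma diffop_sumr (I : Type) (r : seq I) (P : pred I) (F : I -> poly) u :
  diffop u (\sum_(i <- r | P i) F i) = \sum_(i <- r | P i) diffop u (F i).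
Proof.
exact: (big_morph (diffop u) (diffopDr u) (diffop0r u)).
Qed.

Lemma diffopX m f : diffop 'X_[m] f = f^`M[m].
Proof. by rewrite /diffop msuppX big_seq1 mcoeffX eqxx scale1r. Qed.

Lemma diffopM u v f : diffop (u * v) f = diffop u (diffop v f).
Proof.
rewrite [in LHS](mpolyE u) mulr_suml diffop_suml /diffop.
apply: eq_bigr => m _; rewrite -scalerAl -/(diffop _ f) diffopZl; congr (_ *: _).
rewrite -/(diffop v f) -[RHS]diffopX [in LHS](mpolyE v) mulr_sumr diffop_suml.
rewrite [in RHS]/(diffop v f) diffop_sumr; apply: eq_bigr => m' _.
rewrite -scalerAr diffopZl diffopZr -mpolyXD !diffopX addmC.
by rewrite mderivmDm.
Qed.

Lemma diffopC u v f : diffop u (diffop v f) = diffop v (diffop u f).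
Proof. by rewrite -!diffopM mulrC. Qed.

Lemma mderivm_homog d m f :
  f \is d.-homog -> f^`M[m] \is (d - mdeg m).-homog.
Proof.
move=> hf; apply/dhomogP => m'; rewrite mcoeff_msupp mcoeff_mderivm => nz.
have : f@_(m + m') != 0 by apply: contraNneq nz => ->; rewrite mul0rn.
rewrite -mcoeff_msupp => /(dhomog_mf hf) /= <-.
by rewrite mdegD addKn.
Qed.

Lemma diffop_homog d e u f :
  f \is d.-homog -> u \is e.-homog -> diffop u f \is (d - e).-homog.
Proof.
move=> hf hu; rewrite /diffop big_seq rpred_sum // => m mu.
by rewrite dhomogZ // -(dhomog_mf hu mu) mderivm_homog.
Qed.

(** The factorial of a multi-index: the constant obtained when ['X_[m]] acts as an operator on
    itself. *)
Definition mfact m : nat := \prod_(i < n) (m i)`!.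

Lemma mfact_neq0 m : (mfact m)%:R != 0 :> C.
Proof. by rewrite pnatr_eq0 -lt0n prodn_gt0 // => i; apply: fact_gt0. Qed.

Lemma dhomog0_polyC f : f \is 0.-homog -> f = (f@_0%MM)%:MP.
Proof.
move=> hf; apply/mpolyP => m; rewrite mcoeffC.
have [->|m0] := eqVneq m 0%MM; first by rewrite mulr1.
by rewrite mulr0 (dhomog_nemf_coeff hf) // mdeg_eq0.
Qed.

Lemma mderivm_top e m f :
  f \is e.-homog -> mdeg m = e -> f^`M[m] = (f@_m * (mfact m)%:R)%:MP.
Proof.
move=> hf me; have := mderivm_homog m hf; rewrite me subnn => /dhomog0_polyC ->.
rewrite mcoeff_mderivm addm0 mulr_natr; congr (_ *+ _)%:MP_[n].
by apply: eq_bigr => i _; rewrite ffactnn.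
Qed.

(** Monomial operators read off coefficients up to the factor [mfact m], nonzero in characteristic
    zero. This is the nondegeneracy of the apolarity pairing. *)
Lemma diffop_eq0 e f :
  f \is e.-homog -> (forall u, u \is e.-homog -> diffop u f = 0) -> f = 0.
Proof.
move=> hf f0; apply/mpolyP => m; rewrite mcoeff0.
have [me|me] := eqVneq (mdeg m) e; last by rewrite (dhomog_nemf_coeff hf).
have := f0 'X_[m]; rewrite dhomogX /= me eqxx => /(_ isT) /eqP.
rewrite diffopX (mderivm_top hf me) mpolyC_eq0 mulf_eq0.
by rewrite (negbTE (mfact_neq0 m)) orbF => /eqP.
Qed.

Lemma mulX_mderiv (i : 'I_n) m :
  'X_i * ('X_[m] : poly)^`M(i) = (m i)%:R *: 'X_[m].
Proof.
rewrite mderivX -scalerAr -mpolyXD; case: (eqVneq (m i) 0%N) => [->|mi].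
  by rewrite !scale0r.
by rewrite addmC submK // lep1mP.
Qed.

Lemma euler e f : f \is e.-homog -> \sum_i 'X_i * f^`M(i) = e%:R *: f.
Proof.
move=> hf; rewrite {2}(mpolyE f) scaler_sumr.
transitivity (\sum_i \sum_(m <- msupp f) f@_m *: ('X_i * ('X_[m])^`M(i))).
  apply: eq_bigr => i _; rewrite {1}(mpolyE f) linear_sum mulr_sumr.
  by apply: eq_bigr => m _ /=; rewrite mderivZ -scalerAr.
rewrite exchange_big big_seq [RHS]big_seq; apply: eq_bigr => m mf.
rewrite -scaler_sumr (eq_bigr (fun i => (m i)%:R *: 'X_[m])); last first.
  by move=> i _; rewrite mulX_mderiv.
by rewrite -scaler_suml -natr_sum -mdegE (dhomog_mf hf mf) !scalerA mulrC.
Qed.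

Lemma linear_form_homog (a : 'I_n -> C) : linear_form a \is 1.-homog.
Proof. by rewrite rpred_sum // => i _; rewrite dhomogZ // dhomogX /= mdeg1. Qed.

Lemma linear_form_pow_homog (a : 'I_n -> C) k : linear_form a ^+ k \is k.-homog.
Proof. by have := dhomogMn k (linear_form_homog a); rewrite mul1n. Qed.

(** Induction on [e]: by Euler's identity, applying [linear_form a] once and evaluating at [a] gives
    the degree times the value of [f]. *)
Lemma diffop_linear_pow e f (a : 'I_n -> C) :
  f \is e.-homog -> diffop (linear_form a ^+ e) f = (e`!%:R * f.@[a])%:MP.
Proof.
elim: e f => [|e IH] f hf.
  rewrite expr0 -mpolyX0 diffopX mderivm0m mul1r {1 2}(dhomog0_polyC hf).
  by rewrite mevalC.
rewrite exprSr diffopM IH; last first.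
  by have := diffop_homog hf (linear_form_homog a); rewrite subn1.
congr (_%:MP_[n]); rewrite factS mulnC natrM -mulrA; congr (_ * _).
rewrite -mevalZ -(euler hf) /linear_form diffop_suml !raddf_sum.
apply: eq_bigr => i _ /=.
by rewrite diffopZl diffopX mderivmU1m mevalZ mevalM mevalXU.
Qed.

(** The multinomial formula, from computing [linear_form a ^+ e] on ['X_[m]] both by coefficients
    and by [diffop_linear_pow]. *)
Lemma mcoeff_linear_pow (a : 'I_n -> C) e m : mdeg m = e ->
  (linear_form a ^+ e)@_m = e`!%:R / (mfact m)%:R * ('X_[m] : poly).@[a].
Proof.
move=> me; have hL := linear_form_pow_homog a e.
have hX : ('X_[m] : poly) \is e.-homog by rewrite dhomogX /= me.
have /eqP := diffop_linear_pow a hX.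
have -> : diffop (linear_form a ^+ e) 'X_[m] =
          ((linear_form a ^+ e)@_m * (mfact m)%:R)%:MP.
  have [mL|mL] := boolP (m \in msupp (linear_form a ^+ e)); last first.
    rewrite (memN_msupp_eq0 mL) mul0r mpolyC0 /diffop big_seq big1 // => m' m'L.
    rewrite (mderivm_top hX) ?(dhomog_mf hL m'L) // mcoeffX.
    by case: eqP => [E|_]; rewrite ?mul0r ?scaler0 //; rewrite E m'L in mL.
  rewrite /diffop (bigD1_seq m) //= big_seq_cond big1 => [|m' /andP[m'L m'm]].
    rewrite (mderivm_top hX me) mcoeffX eqxx mul1r addr0.
    by rewrite -mul_mpolyC mpolyCM.
  rewrite (mderivm_top hX) ?(dhomog_mf hL m'L) // mcoeffX eq_sym (negbTE m'm).
  by rewrite mul0r scaler0.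
rewrite mpolyC_eq => /eqP e1; rewrite mulrAC -e1 mulfK //.
exact: mfact_neq0.
Qed.

Lemma dhomog1_linear_form f :
  f \is 1.-homog -> f = linear_form (fun i => f@_U_(i)%MM).
Proof.
move=> hf; apply/mpolyP => m; rewrite raddf_sum /=.
rewrite (eq_bigr (fun i => f@_U_(i)%MM * (U_(i)%MM == m)%:R)); last first.
  by move=> i _; rewrite mcoeffZ mcoeffX.
have [/mdeg1P[i /eqP ->]|m1] := boolP (mdeg m == 1%N).
  rewrite (bigD1 i) //= eqxx mulr1 big1 ?addr0 // => j ji.
  by rewrite eq_mnm1 (negbTE ji) mulr0.
rewrite (dhomog_nemf_coeff hf m1) big1 // => i _; case: eqP => [E|]; last first.
  by rewrite mulr0.
by rewrite -E mdeg1 in m1.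
Qed.

End DiffOp.

(** * Bases of graded pieces of quotients *)

Section Monomials.
Variable n : nat.

Lemma mem_monomials e (m : 'X_{1..n}) : (m \in monomials n e) = (mdeg m == e).
Proof.
apply/mapP/idP => [[x]|me]; first by rewrite mem_filter => /andP[/eqP xe _] ->; apply/eqP.
have me1 : (mdeg m < e.+1)%N by rewrite (eqP me).
by exists (BMultinom me1) => //; rewrite mem_filter me mem_enum.
Qed.

Lemma monomials_uniq e : uniq (monomials n e).
Proof.
rewrite map_inj_uniq => [|x y /eqP]; first by rewrite filter_uniq // enum_uniq.
by rewrite -bmeqP => /eqP.
Qed.

Lemma mdeg_nth_monomials e (i : 'I_(ncoord n e)) :
  mdeg (nth 0%MM (monomials n e) i) = e.
Proof. by apply/eqP; rewrite -mem_monomials mem_nth. Qed.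

Lemma dhomog_coefvE (F : fieldType) e (p : {mpoly F[n]}) : p \is e.-homog ->
  p = \sum_i coefv e p 0 i *: 'X_[nth 0%MM (monomials n e) i].
Proof.
move=> hp; pose G m := p@_m *: ('X_[m] : {mpoly F[n]}).
rewrite (eq_bigr (fun i : 'I__ => G (nth 0%MM (monomials n e) i))); last first.
  by move=> i _; rewrite mxE.
rewrite -(big_mkord xpredT (fun i => G (nth 0%MM (monomials n e) i))).
rewrite -(big_nth 0%MM xpredT G) [LHS]mpolyE.
rewrite [RHS](bigID (fun m => m \in msupp p)) /= [X in _ + X]big1 ?addr0.
  rewrite -[RHS]big_filter; apply: perm_big; apply: uniq_perm.
  - exact: msupp_uniq.
  - by rewrite filter_uniq // monomials_uniq.
  move=> m; rewrite mem_filter mem_monomials; case: (boolP (m \in _)) => //= mp.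
  by rewrite (dhomog_mf hp mp) eqxx.
by move=> m /memN_msupp_eq0 mp; rewrite /G mp scale0r.
Qed.

End Monomials.

Lemma ncoord_bin n e : ncoord n.+1 e = 'C(n + e, e).
Proof.
rewrite addnC -size_basis; apply/perm_size/uniq_perm.
- exact: monomials_uniq.
- exact: uniq_basis.
by move=> m; rewrite mem_monomials basis_cover.
Qed.

Section LinearAlgebra.
Variable F : fieldType.

Lemma wide_kernel p q (M : 'M[F]_(p, q)) : (q < p)%N ->
  exists2 v : 'rV[F]_p, v != 0 & v *m M = 0.
Proof.
move=> qp; have /rowV0Pn [x /sub_kermxP xM x0] : kermx M != 0.
  by rewrite -mxrank_eq0 mxrank_ker subn_eq0 -ltnNge (leq_ltn_trans (rank_leq_col _)).
by exists x.
Qed.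

End LinearAlgebra.

Section Quotient.
Variables (R : realType) (n : nat).
Local Notation C := R[i].
Local Notation poly := {mpoly C[n]}.

Record linear_subspace (J : set poly) : Prop := {
  ls_0 : J 0;
  ls_add : forall p q, J p -> J q -> J (p + q);
  ls_scale : forall c p, J p -> J (c *: p) }.

Variable J : set poly.
Hypothesis hJ : linear_subspace J.

Lemma ls_opp p : J p -> J (- p).
Proof. by move=> Jp; rewrite -scaleN1r; apply: ls_scale. Qed.

Lemma ls_sub p q : J p -> J q -> J (p - q).
Proof. by move=> Jp Jq; apply: ls_add => //; apply: ls_opp. Qed.

Lemma ls_sum (I : Type) (r : seq I) (P : pred I) (G : I -> poly) :
  (forall i, P i -> J (G i)) -> J (\sum_(i <- r | P i) G i).
Proof.
move=> h; elim/big_ind: _ => //; [exact: ls_0|exact: ls_add].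
Qed.

Definition quot_spanned (e r : nat) : Prop :=
  exists b : 'I_r -> poly, forall p, p \is e.-homog ->
    exists c : 'I_r -> C, J (p - \sum_i c i *: b i).

Definition quot_free (r : nat) (b : 'I_r -> poly) : Prop :=
  forall c : 'I_r -> C, J (\sum_i c i *: b i) -> forall i, c i = 0.

(** If [r < r'], the matrix expressing the [b i] through a spanning family has more rows than
    columns, and a kernel vector is a relation modulo [J]. *)
Lemma quot_free_leq e r r' (b : 'I_r' -> poly) : quot_spanned e r ->
  (forall i, b i \is e.-homog) -> quot_free b -> (r' <= r)%N.
Proof.
move=> [a ha] hb bfree; rewrite leqNgt; apply/negP => rr'.
have /choice [M hM] := fun i => ha _ (hb i).
have [v v0 vM] := wide_kernel (\matrix_(i, j) M i j) rr'.
case/eqP: v0; apply/rowP => i; rewrite mxE.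
apply: (bfree (fun i => v 0 i)) => {i}.
have -> : \sum_i v 0 i *: b i =
    \sum_i v 0 i *: (b i - \sum_j M i j *: a j); last first.
  by apply: ls_sum => i _; apply: ls_scale.
under [RHS]eq_bigr do rewrite scalerBr; rewrite sumrB.
suff -> : \sum_i v 0 i *: (\sum_j M i j *: a j) = 0 by rewrite subr0.
under eq_bigr do rewrite scaler_sumr; rewrite exchange_big big1 //= => j _.
under eq_bigr do rewrite scalerA; rewrite -scaler_suml.
have /rowP/(_ j) := vM; rewrite !mxE => e0.
by under eq_bigr do rewrite -[M _ _](mxE matrix_key (fun i j => M i j)); rewrite e0 scale0r.
Qed.

Lemma quot_spanned_ncoord e : quot_spanned e (ncoord n e).
Proof.
exists (fun i => 'X_[nth 0%MM (monomials n e) i]) => p hp.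
exists (fun i => coefv e p 0 i); rewrite -dhomog_coefvE // subrr; exact: ls_0.
Qed.

Lemma quot_basis_spanned e r (b : r.-tuple poly) :
  quot_basis J e b -> quot_spanned e r.
Proof. by case=> _ hb _; exists (tnth b). Qed.

(** A free family of maximal size is a basis; the number of monomials bounds the size. *)
Lemma quot_basis_exists e : exists r, exists b : r.-tuple poly, quot_basis J e b.
Proof.
pose P r := `[< exists b : r.-tuple poly,
  (forall i, tnth b i \is e.-homog) /\ quot_free (tnth b) >].
have P0 : exists r, P r.
  by exists 0; apply/asboolP; exists [tuple]; split=> [[]|c _ []].
have Pb r : P r -> (r <= ncoord n e)%N.
  by move=> /asboolP[b [hb bfree]]; exact: quot_free_leq (quot_spanned_ncoord e) hb bfree.
case: (ex_maxnP P0 Pb) => r /asboolP[b [hb bfree]] rmax; exists r, b; split=> // p hp.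
have [c Jc] : exists2 c : 'I_r.+1 -> C, J (\sum_i c i *: tnth [tuple of p :: b] i) &
    exists i, c i != 0.
  apply/not_exists2P => h; suff /rmax : P r.+1 by rewrite ltnn.
  apply/asboolP; exists [tuple of p :: b]; split=> [i|c Jc i].
    by case: (unliftP ord0 i) => [j ->|->]; rewrite ?tnthS ?tnth0.
  by have [//|nz] := h c; apply/eqP/negPn/negP => ci; apply: nz; exists i.
move: Jc; rewrite big_ord_recl tnth0; under eq_bigr do rewrite tnthS.
set c0 := c ord0 => Jc [i ci].
(* Freeness of [b] forces the coefficient of [p] to be nonzero, so the relation can be solved for
   [p]. *)
have c00 : c0 != 0.
  apply: contraNneq ci => c00; move: Jc; rewrite c00 scale0r add0r.
  move=> /(bfree (fun i => c (lift ord0 i))) h.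
  by case: (unliftP ord0 i) => [j ->|->]; [rewrite h|rewrite -/c0 c00].
exists (fun i => - (c (lift ord0 i) / c0)).
under eq_bigr do rewrite scaleNr mulrC -scalerA; rewrite sumrN opprK -scaler_sumr.
have -> : p = c0^-1 *: (c0 *: p) by rewrite scalerA mulVf // scale1r.
by rewrite -scalerDr; apply: ls_scale.
Qed.

Lemma quot_basis_size e r (b : r.-tuple poly) r' (b' : r'.-tuple poly) :
  quot_basis J e b -> quot_basis J e b' -> r = r'.
Proof.
move=> hb hb'; have sb := quot_basis_spanned hb; have sb' := quot_basis_spanned hb'.
case: hb => h1 _ h2; case: hb' => h1' _ h2'.
by apply/eqP; rewrite eqn_leq (quot_free_leq sb' h1 h2) (quot_free_leq sb h1' h2').
Qed.

(** A basis always exists, so [quot_dim] is never the default value of [xget] on an empty set. *)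
Lemma quot_dimP e : exists b : (quot_dim J e).-tuple poly, quot_basis J e b.
Proof.
have := quot_basis_exists e; rewrite /quot_dim.
by case: xgetP => [r -> //|h [r hr]]; have /= := h r.
Qed.

Lemma quot_dimE e r (b : r.-tuple poly) : quot_basis J e b -> quot_dim J e = r.
Proof. by have [b' hb'] := quot_dimP e; move=> hb; exact: quot_basis_size hb' hb. Qed.

End Quotient.

(** * The apolar algebra *)

(** If [e] is at most the peak [j], the sequence climbs from [i] to [e]. Otherwise [a i] equals
    [a (d - i)], and [e <= d - i] are both on the descending side. *)
Lemma unimodal_sym_leq d (a : nat -> nat) i e : unimodal d a ->
  (forall j, (j <= d)%N -> a j = a (d - j)%N) ->
  (i <= e)%N -> (e + i <= d)%N -> (a i <= a e)%N.
Proof.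
move=> [j jd [up down]] sym ie eid.
have upto t : (i + t <= j)%N -> (a i <= a (i + t))%N.
  elim: t => [|t IH] h; first by rewrite addn0.
  by rewrite addnS in h *; apply: leq_trans (IH (ltnW h)) (up _ h).
have downto x t : (j <= x)%N -> (x + t <= d)%N -> (a (x + t) <= a x)%N.
  move=> jx; elim: t => [|t IH] h; first by rewrite addn0.
  rewrite addnS in h *; apply: leq_trans (down _ _) (IH (ltnW h)).
  by rewrite h andbT (leq_trans jx) // leq_addr.
have [ej|/ltnW je] := leqP e j; first by have := upto (e - i)%N; rewrite subnKC // => ->.
rewrite (sym i) ?(leq_trans ie) ?(leq_trans _ eid) ?leq_addr //.
have edi : (e <= d - i)%N by rewrite leq_subRL ?(leq_trans (leq_addl e i)) // addnC.
by have := downto e (d - i - e)%N je; rewrite subnKC // leq_subr; apply.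
Qed.

Section Annihilator.
Variables (R : realType) (n d : nat).
Local Notation C := R[i].
Local Notation poly := {mpoly C[n]}.
Variable f : poly.
Hypothesis hf : f \is d.-homog.

Lemma Ann_subspace : linear_subspace (Ann f).
Proof.
rewrite /Ann; split=> [|p q /= hp hq|c p /= hp] /=.
- exact: diffop0l.
- by rewrite diffopDl hp hq addr0.
- by rewrite diffopZl hp scaler0.
Qed.

Lemma Ann_mulr u v : Ann f u -> Ann f (u * v).
Proof. by rewrite /Ann /= mulrC diffopM => ->; exact: diffop0r. Qed.

(** The form [diffop u f] has degree [s] and is killed by all forms of degree [s], which are
    combinations of the [b] modulo [Ann f]. *)
Lemma Ann_perfect_pairing s u r (b : r.-tuple poly) : (s <= d)%N ->
  u \is (d - s).-homog -> quot_basis (Ann f) s b ->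
  (forall j, Ann f (u * tnth b j)) -> Ann f u.
Proof.
move=> sd hu [hb bspan _] ub.
have hd := diffop_homog hf hu; rewrite subKn // in hd.
apply: (diffop_eq0 hd) => v hv.
have [c hc] := bspan v hv; rewrite diffopC -diffopM.
have -> : u * v = (v - \sum_j c j *: tnth b j) * u + \sum_j c j *: (u * tnth b j).
  rewrite mulrBl mulr_suml [v * u]mulrC; under [X in _ - X]eq_bigr do rewrite -scalerAl mulrC.
  by rewrite subrK.
apply: (ls_add Ann_subspace); first exact: Ann_mulr.
by apply: (ls_sum Ann_subspace) => j _; apply: (ls_scale Ann_subspace).
Qed.

(** The pairing of degrees [j] and [d - j] into constants has trivial left kernel, so its matrix
    cannot have more rows than columns. *)
Lemma hilb_dual_leq j : (j <= d)%N -> (hilb f j <= hilb f (d - j))%N.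
Proof.
move=> jd; have [a [ha _ afree]] := quot_dimP Ann_subspace j.
have [b hb] := quot_dimP Ann_subspace (d - j).
rewrite leqNgt; apply/negP.
have hbj i : tnth b i \is (d - j).-homog by case: hb.
move=> /(wide_kernel (\matrix_(i, t) (diffop (tnth a i * tnth b t) f)@_0%MM)) [v v0 vM].
case/eqP: v0; apply/rowP => i; rewrite mxE; apply: (afree (v 0)) => {i}.
apply: (Ann_perfect_pairing (s := (d - j)%N) _ _ hb); rewrite ?leq_subr // ?subKn //.
  by apply: rpred_sum => i _; rewrite dhomogZ.
move=> t; rewrite /Ann /= mulr_suml diffop_suml.
have /rowP/(_ t) := vM; rewrite !mxE => e0; rewrite -[RHS](mpolyC0 n) -e0 raddf_sum.
apply: eq_bigr => i _ /=; rewrite mxE -scalerAl diffopZl.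
rewrite mpolyCM mul_mpolyC; congr (_ *: _); apply: dhomog0_polyC.
have := diffop_homog hf (dhomogM (ha i) (hbj t)).
by rewrite subnKC // subnn.
Qed.

Lemma hilb_sym j : (j <= d)%N -> hilb f j = hilb f (d - j).
Proof.
move=> jd; apply/eqP; rewrite eqn_leq hilb_dual_leq //=.
by have := hilb_dual_leq (leq_subr j d); rewrite subKn.
Qed.

Lemma hilb_unimodal_leq i e : unimodal d (hilb f) ->
  (i <= e)%N -> (e + i <= d)%N -> (hilb f i <= hilb f e)%N.
Proof. by move=> h; apply: unimodal_sym_leq h hilb_sym. Qed.

(** Degree 0 lies outside the range of [k_concise]; there the claim follows from [f != 0]. *)
Lemma Ann_concise_eq0 k j u : f != 0 -> k_concise k f -> (j <= k)%N ->
  u \is j.-homog -> Ann f u -> u = 0.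
Proof.
move=> f0 hk; case: j => [_ hu|j jk hu]; last by apply: (hk j.+1).
rewrite (dhomog0_polyC hu) /Ann /= -[_%:MP]mulr1 mul_mpolyC diffopZl.
rewrite -mpolyX0 diffopX mderivm0m => /eqP.
by rewrite scaler_eq0 (negbTE f0) orbF => /eqP ->; rewrite scale0r.
Qed.

Lemma hilb_concise k : f != 0 -> k_concise k f -> hilb f k = ncoord n k.
Proof.
move=> f0 hk.
pose b := [tuple 'X_[nth 0%MM (monomials n k) i] : poly | i < ncoord n k].
apply: (quot_dimE Ann_subspace (b := b)).
have bE i : tnth b i = 'X_[nth 0%MM (monomials n k) i] by rewrite tnth_mktuple.
have hb i : tnth b i \is k.-homog by rewrite bE dhomogX /= mdeg_nth_monomials.
split=> // [p hp|c Jc i].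
  exists (fun i => coefv k p 0 i); under eq_bigr do rewrite bE.
  by rewrite -dhomog_coefvE // subrr; exact: ls_0 Ann_subspace.
have hs : \sum_i c i *: tnth b i \is k.-homog.
  by apply: rpred_sum => j _; rewrite dhomogZ.
have := Ann_concise_eq0 f0 hk (leqnn k) hs Jc.
move=> /(congr1 (mcoeff (nth 0%MM (monomials n k) i))).
rewrite mcoeff0 raddf_sum (bigD1 i) //= big1 ?addr0.
  by rewrite mcoeffZ bE mcoeffX eqxx mulr1.
move=> j ji; rewrite mcoeffZ bE mcoeffX nth_uniq ?monomials_uniq //.
by rewrite (negbTE ji : (j == i :> nat) = false) mulr0.
Qed.

End Annihilator.

(** * Lefschetz maps and Hessians *)

Section Hessian.
Variables (R : realType) (n d l s p q : nat).
Local Notation C := R[i].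
Local Notation poly := {mpoly C[n]}.
Variable f : poly.
Hypotheses (hf : f \is d.-homog) (hsl : (s + l <= d)%N).
Variables (alpha : p.-tuple poly) (beta : q.-tuple poly).
Hypotheses (halpha : quot_basis (Ann f) l alpha)
           (hbeta : quot_basis (Ann f) s beta).

Let m := (d - s - l)%N.

Let ml : (m + l = d - s)%N.
Proof. by rewrite /m subnK // leq_subRL // (leq_trans _ hsl) // leq_addr. Qed.

(** The Hessian entry is a form of degree [m], so [m] derivatives along [a] evaluate it at [a], up
    to the factorial of [m]. Thus the Hessian at [a] represents multiplication by
    [linear_form a ^+ m] from degree [l] to degree [d - s], the dual of degree [s]. *)
Lemma diffop_pow_hess (a : 'I_n -> C) i j :
  diffop (linear_form a ^+ m * (tnth alpha i * tnth beta j)) f =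
  (m`!%:R * (hess f alpha beta i j).@[a])%:MP.
Proof.
rewrite diffopM mxE; apply: diffop_linear_pow.
case: halpha => ha _ _; case: hbeta => hb _ _.
by have := diffop_homog hf (dhomogM (ha i) (hb j)); rewrite addnC subnDA.
Qed.

Lemma Ann_hess_kernel (a : 'I_n -> C) (c : 'I_p -> C) :
  (forall j, \sum_i c i * (hess f alpha beta i j).@[a] = 0) ->
  Ann f (linear_form a ^+ m * \sum_i c i *: tnth alpha i).
Proof.
move=> hc; case: (halpha) => ha _ _.
apply: (Ann_perfect_pairing hf _ _ hbeta).
- by rewrite (leq_trans _ hsl) // leq_addr.
- rewrite -ml; apply: dhomogM; first exact: linear_form_pow_homog.
  by apply: rpred_sum => i _; rewrite dhomogZ.
move=> j; rewrite /Ann /= -mulrA mulr_suml mulr_sumr diffop_suml.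
rewrite (eq_bigr (fun i => m`!%:R *: (c i * (hess f alpha beta i j).@[a])%:MP)).
  by rewrite -scaler_sumr -raddf_sum /= hc mpolyC0 scaler0.
move=> i _; rewrite -scalerAl -scalerAr diffopZl diffop_pow_hess.
by rewrite -!mul_mpolyC -!mpolyCM mulrCA.
Qed.

(** Where a nonzero entry of [v] does not vanish, the specialized vector gives a nonzero class
    killed by the power of the linear form. *)
Lemma hess_kernel_generic (v : 'rV[poly]_p) : v != 0 -> v *m hess f alpha beta = 0 ->
  generically (fun a => ~ mul_pow_injective f (linear_form a) l m).
Proof.
move=> v0 vH; have [i vi] : exists i, v 0 i != 0 by apply/rV0Pn.
exists (v 0 i) => // a vai inj; case: (halpha) => ha _ afree.
case/eqP: vai; apply: (afree (fun i => (v 0 i).@[a])).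
rewrite -[X in Ann f X]subr0; apply: inj; rewrite ?rpred0 //.
  by apply: rpred_sum => j _; rewrite dhomogZ.
rewrite mulr0 subr0; apply: Ann_hess_kernel => j.
have /rowP/(_ j)/(congr1 (meval a)) := vH; rewrite !mxE meval0 => e0.
by rewrite -[RHS]e0 raddf_sum; apply: eq_bigr => k _ /=; rewrite mevalM.
Qed.

Lemma hess_right_inverse_injective (D : poly) (W : 'M[poly]_(q, p)) (a : 'I_n -> C) :
  hess f alpha beta *m W = D%:M -> D.@[a] != 0 ->
  mul_pow_injective f (linear_form a) l m.
Proof.
move=> HW Da u v hu hv huv; case: (halpha) => _ aspan _.
have [c hc] := aspan (u - v) (rpredB hu hv).
have fact0 : m`!%:R != 0 :> C by rewrite pnatr_eq0 -lt0n fact_gt0.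
(* The coordinates of [u - v] lie in the left kernel of the Hessian at [a], since its product with
   the power of the linear form is in [Ann f]. *)
have cH j : \sum_i c i * (hess f alpha beta i j).@[a] = 0.
  apply/eqP; rewrite -(inj_eq (mulfI fact0)) mulr0 -(mpolyC_eq0 n) mulr_sumr raddf_sum.
  rewrite (eq_bigr (fun i =>
      diffop (linear_form a ^+ m * (c i *: tnth alpha i) * tnth beta j) f)) => [|i _].
    rewrite -diffop_suml -mulr_suml -mulr_sumr.
    rewrite -[X in _ * X * _](subrKC (u - v)) -[X in u - v + X]opprB mulrBr mulrBl diffopBl.
    have /= -> : Ann f (linear_form a ^+ m * (u - v) * tnth beta j).
      by apply: Ann_mulr; rewrite mulrBr.
    have /= -> : Ann f (linear_form a ^+ m * (u - v - \sum_i c i *: tnth alpha i) *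
                        tnth beta j).
      by apply: Ann_mulr; rewrite mulrC; apply: Ann_mulr.
    by rewrite subr0.
  rewrite -scalerAr -scalerAl -mulrA diffopZl diffop_pow_hess -mul_mpolyC -mpolyCM.
  by rewrite mulrCA.
suff c0 i : c i = 0.
  move: hc; rewrite big1 ?subr0 // => i _; by rewrite c0 scale0r.
(* Multiplying that relation by [W] at [a] replaces the Hessian by the nonzero scalar [D.@[a]]. *)
apply: (mulIf Da); rewrite mul0r.
transitivity (\sum_k c k * (D *+ (k == i)).@[a]).
  rewrite (bigD1 i) //= eqxx mulr1n big1 ?addr0 // => k ki.
  by rewrite (negbTE ki) mulr0n meval0 mulr0.
rewrite (eq_bigr (fun k => \sum_j c k * (hess f alpha beta k j).@[a] * (W j i).@[a])).
  by rewrite exchange_big big1 //= => j _; rewrite -mulr_suml cH mul0r.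
move=> k _; have /matrixP/(_ k i)/(congr1 (meval a)) := HW.
rewrite !mxE raddf_sum /= => <-; rewrite mulr_sumr.
by apply: eq_bigr => j _; rewrite mevalM mulrA mxE.
Qed.

Lemma degenerate_generic : (p <= q)%N ->
  degenerate (hess f alpha beta) <->
  generically (fun a : 'I_n -> C => ~ mul_pow_injective f (linear_form a) l m).
Proof.
move=> pq; rewrite /degenerate (minn_idPl pq); split.
  by case/fraction_mx_kernel => v; apply: hess_kernel_generic.
move=> [g g0 hg]; apply/negPn/negP => /negP/fraction_mx_right_inverse[D D0 [W HW]].
(* A point where both [g] and [D] are nonzero would make the same map injective and not
   injective. *)
have : g * D = 0.
  apply: mpoly_eq0_of_meval => a; rewrite mevalM.
  apply/eqP/negPn/negP; rewrite mulf_eq0 negb_or => /andP[ga Da].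
  by case: (hg a ga); apply: hess_right_inverse_injective HW Da.
by move/eqP; rewrite mulf_eq0 (negbTE g0) (negbTE D0).
Qed.

End Hessian.

(** * Regularity of the generic linear form *)

Section GenericLinearForm.
Variables (R : realType) (n : nat).
Local Notation C := R[i].
Local Notation poly := {mpoly C[n]}.
Local Notation bipoly := {mpoly {mpoly C[n]}[n]}.
Implicit Types (U : bipoly) (J : set poly).

Definition coefs_in J U : Prop := forall m, J U@_m.

Definition coefs_homog (e : nat) U : Prop := forall m, U@_m \is e.-homog.

(* In [bipoly] the outer variables stand for the coefficients of a linear form;
   the inner ones are those of the ring of differential operators. *)
Definition generic_form : bipoly := \sum_i ('X_i : poly) *: 'X_i.

Local Notation constant_coefs := (map_mpoly (@mpolyC n C)).

Lemma mcoeffMXU (U : bipoly) (j : 'I_n) m :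
  (U * 'X_j)@_m = if m j == 0%N then 0 else U@_(m - U_(j)).
Proof.
case: eqP => [mj|/eqP mj].
  apply: memN_msupp_eq0; rewrite (perm_mem (msuppMX _ _)); apply/negP => /mapP[k _ e].
  by move: mj; rewrite e mnmDE mnm1E eqxx.
have -> : m = (U_(j) + (m - U_(j)))%MM by rewrite addmC submK // lep1mP.
by rewrite mcoeffMX addmC addmK.
Qed.

Lemma mcoeff_generic_form_mul U m :
  (generic_form * U)@_m =
  \sum_i (if m i == 0%N then 0 else 'X_i * U@_(m - U_(i))).
Proof.
rewrite /generic_form mulr_suml raddf_sum; apply: eq_bigr => i _ /=.
by rewrite -scalerAl mcoeffZ mulrC [_ * U]mulrC mcoeffMXU; case: eqP; rewrite ?mul0r // mulrC.
Qed.

Lemma generic_form_mul_homog e U :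
  coefs_homog e U -> coefs_homog e.+1 (generic_form * U).
Proof.
move=> hU m; rewrite mcoeff_generic_form_mul; apply: rpred_sum => i _.
case: eqP => _; first exact: rpred0.
by rewrite -add1n; apply: dhomogM => //; rewrite dhomogX /= mdeg1.
Qed.

Lemma generic_form_pow_homog e k U :
  coefs_homog e U -> coefs_homog (k + e) (generic_form ^+ k * U).
Proof.
move=> hU; elim: k => [|k IH]; first by rewrite mul1r.
by rewrite exprS -mulrA addSn; apply: generic_form_mul_homog.
Qed.

Lemma meval_generic_form (a : 'I_n -> C) :
  generic_form.@[fun i => (a i)%:MP] = linear_form a.
Proof.
rewrite raddf_sum; apply: eq_bigr => i _ /=.
by rewrite mevalZ mevalXU mulrC mul_mpolyC.
Qed.

Lemma meval_constant_coefs (a : 'I_n -> C) (v : poly) :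
  (constant_coefs v).@[fun i => (a i)%:MP] = (v.@[a])%:MP.
Proof.
elim/mpolyind: v => [|c m v _ _ IH]; first by rewrite rmorph0 !meval0 mpolyC0.
rewrite [map_mpoly _ _]raddfD [LHS]mevalD [in RHS]mevalD mpolyCD.
congr (_ + _); last exact: IH.
rewrite /= map_mpolyZ map_mpolyX [LHS]mevalZ [in RHS]mevalZ.
rewrite [in LHS]mevalX [in RHS]mevalX.
rewrite mpolyCM; congr (_ * _); rewrite rmorph_prod.
by apply: eq_bigr => i _; rewrite rmorphXn.
Qed.

Lemma coefs_in_mul_constant J v U : linear_subspace J ->
  coefs_in J U -> coefs_in J (constant_coefs v * U).
Proof.
move=> hJ hU m; rewrite mcoeffM; apply: (ls_sum hJ) => k _.
by rewrite mcoeff_map_mpoly mul_mpolyC; apply: (ls_scale hJ).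
Qed.

(** For each inner monomial [k], the coefficient at [k] of the operator family applied to [f] is a
    polynomial in [a] vanishing everywhere, hence identically. *)
Lemma coefs_in_Ann f U : (forall a : 'I_n -> C, Ann f U.@[fun i => (a i)%:MP]) ->
  coefs_in (Ann f) U.
Proof.
move=> hU m; apply/mpolyP => k; rewrite mcoeff0.
pose P : poly := \sum_(m <- msupp U) (diffop U@_m f)@_k *: 'X_[m].
have P0 : P = 0.
  apply: mpoly_eq0_of_meval => a; have /(congr1 (mcoeff k)) := hU a.
  rewrite mcoeff0 mevalE diffop_suml raddf_sum => e0; rewrite -[RHS]e0 /P.
  rewrite [LHS]raddf_sum; apply: eq_bigr => j _ /=; rewrite mevalZ mevalX.
  rewrite mulrC -mcoeffZ -diffopZl; congr ((diffop _ f)@_k).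
  rewrite -mul_mpolyC [RHS]mulrC rmorph_prod; congr (_ * _).
  by apply: eq_bigr => i _; rewrite rmorphXn.
have [mU|/memN_msupp_eq0 ->] := boolP (m \in msupp U); last first.
  by rewrite diffop0l mcoeff0.
have /(congr1 (mcoeff m)) := P0; rewrite mcoeff0 raddf_sum (bigD1_seq m) //= big1.
  by rewrite addr0 mcoeffZ mcoeffX eqxx mulr1.
by move=> j jm; rewrite mcoeffZ mcoeffX (negbTE jm) mulr0.
Qed.

(** [I e] plays the degree [e] part of a homogeneous ideal. Saturation is phrased with a common
    power of each variable, the form the regularity argument produces. *)
Record saturated_graded (I : nat -> set poly) : Prop := {
  sg_ls : forall e, linear_subspace (I e);
  sg_mul : forall e j u p, u \is j.-homog -> I e p -> I (j + e)%N (u * p);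
  sg_sat : forall e T p, p \is e.-homog ->
    (forall i, I (T + e)%N ('X_i ^+ T * p)) -> I e p }.

Variable I : nat -> set poly.
Hypothesis hI : saturated_graded I.

(* The coefficient of [generic_form * U] at [m + U_(i)] expresses ['X_i * U@_m]
   through the coefficients of [U] of larger degree in the i-th variable; so a
   power of ['X_i] sends [U@_m] into [I]. *)
Lemma generic_form_regular e U : coefs_homog e U ->
  coefs_in (I e.+1) (generic_form * U) -> coefs_in (I e) U.
Proof.
move=> hU hLU.
have shift_in_I i t (m : 'X_{1..n}) :
    (msize U <= m i + t)%N -> I (t + e)%N ('X_i ^+ t * U@_m).
  elim: t m => [|t IH] m.
    rewrite addn0 expr0 mul1r => h; rewrite memN_msupp_eq0; first exact: ls_0 (sg_ls hI e).
    apply: msize_mdeg_ge; apply: leq_trans h _.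
    by rewrite mdegE (bigD1 i) //= leq_addr.
  move=> h; have := hLU (U_(i) + m)%MM; rewrite mcoeff_generic_form_mul.
  rewrite (bigD1 i) //= mnmDE mnm1E eqxx /= addmC addmK => hs.
  have hXt : ('X_i ^+ t : poly) \is t.-homog.
    by have := @dhomogMn n C mdeg 1 'X_i t; rewrite mul1n; apply; rewrite dhomogX /= mdeg1.
  have := sg_mul hI hXt hs; rewrite mulrDr mulrA -exprSr addnS -addSn => hs'.
  set y := _ * \sum_(_ | _) _ in hs'; suff hy : I (t.+1 + e)%N y.
    by have := ls_sub (sg_ls hI _) hs' hy; rewrite addrK.
  (* The remaining coefficients have exponent [m i + 1] in the i-th variable, so the induction
     hypothesis applies with [t]. *)
  rewrite /y mulr_sumr; apply: (ls_sum (sg_ls hI _)) => j ji.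
  case: eqP => [_|/eqP mj]; first by rewrite mulr0; exact: ls_0 (sg_ls hI _).
  rewrite mulrCA addSn -add1n; apply: (sg_mul hI); first by rewrite dhomogX /= mdeg1.
  apply: IH; rewrite mnmBE mnmDE !mnm1E eqxx (negbTE ji) subn0.
  by apply: leq_trans h _; rewrite addnS addnAC addn1.
move=> m; apply: (sg_sat hI (hU m) (T := msize U)) => i.
by apply: shift_in_I; rewrite leq_addl.
Qed.

Lemma generic_form_pow_regular e k U : coefs_homog e U ->
  coefs_in (I (k + e)%N) (generic_form ^+ k * U) -> coefs_in (I e) U.
Proof.
move=> hU; elim: k => [|k IH]; first by rewrite mul1r.
rewrite exprS -mulrA addSn => h; apply/IH/generic_form_regular => //.
exact: generic_form_pow_homog.
Qed.

Lemma mcoeff_family p (v : 'rV[poly]_p) (b : 'I_p -> poly) m :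
  (\sum_i constant_coefs (v 0 i) * (b i)%:MP)@_m = \sum_i (v 0 i)@_m *: b i.
Proof.
rewrite raddf_sum; apply: eq_bigr => i _ /=.
by rewrite mulrC mcoeffCM mcoeff_map_mpoly mulrC mul_mpolyC.
Qed.

(** Multiplication by a power of the generic form is injective on families modulo [I], so the
    Hilbert function cannot drop. The relation is sought with polynomial coefficients, without
    specializing the form. *)
Lemma quot_free_leq_higher e D r r' (b : 'I_r' -> poly) :
  quot_spanned (I (D + e)%N) (D + e) r ->
  (forall i, b i \is e.-homog) -> quot_free (I e) b -> (r' <= r)%N.
Proof.
move=> [a ha] hb bfree; rewrite leqNgt; apply/negP => rr'.
have hLb i : coefs_homog (D + e) (generic_form ^+ D * (b i)%:MP).
  apply: generic_form_pow_homog => m; rewrite mcoeffC.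
  by case: eqP => _; [rewrite mulr1; exact: hb|rewrite mulr0; exact: rpred0].
have /choice [g hg] : forall im : 'I_r' * 'X_{1..n}, exists c : 'I_r -> C,
    I (D + e)%N ((generic_form ^+ D * (b im.1)%:MP)@_im.2 - \sum_j c j *: a j).
  by move=> [i m]; have [c hc] := ha _ (hLb i m); exists c.
(* Row [i] of [N] expresses [generic_form ^+ D * (b i)%:MP] through the [a j] modulo [I], one outer
   monomial at a time. *)
pose N : 'M[poly]_(r', r) := \matrix_(i, j)
  \sum_(m <- msupp (generic_form ^+ D * (b i)%:MP)) g (i, m) j *: 'X_[m].
have NE i j m : (N i j)@_m =
    if m \in msupp (generic_form ^+ D * (b i)%:MP) then g (i, m) j else 0.
  rewrite mxE raddf_sum /=; case: ifP => [mL|/negP mL].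
    rewrite (bigD1_seq m) //= big1 => [|k km]; last first.
      by rewrite mcoeffZ mcoeffX (negbTE km) mulr0.
    by rewrite mcoeffZ mcoeffX eqxx mulr1 addr0.
  rewrite big_seq big1 // => k kL; rewrite mcoeffZ mcoeffX.
  by case: eqP => [E|]; rewrite ?mulr0 //; case: mL; rewrite -E.
have [v v0 vN] : exists2 v : 'rV[poly]_r', v != 0 & v *m N = 0.
  by apply: fraction_mx_kernel; apply: leq_ltn_trans (rank_leq_col _) rr'.
pose E i := generic_form ^+ D * (b i)%:MP -
            \sum_j constant_coefs (N i j) * (a j)%:MP.
have hE i : coefs_in (I (D + e)%N) (E i).
  move=> m; rewrite mcoeffB raddf_sum /=.
  rewrite (eq_bigr (fun j => (N i j)@_m *: a j)) => [|j _]; last first.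
    by rewrite mulrC mcoeffCM mcoeff_map_mpoly mulrC mul_mpolyC.
  under eq_bigr do rewrite NE.
  have [_|/memN_msupp_eq0 ->] := boolP (m \in msupp _); first exact: (hg (i, m)).
  by under eq_bigr do rewrite scale0r; rewrite big1_eq subr0; exact: ls_0 (sg_ls hI _).
pose U := \sum_i constant_coefs (v 0 i) * (b i)%:MP.
have hU : coefs_homog e U.
  by move=> m; rewrite mcoeff_family; apply: rpred_sum => i _; rewrite dhomogZ.
(* Since [v] kills [N], the [a j] cancel and only the errors [E i], with coefficients in [I],
   remain. *)
have LU : generic_form ^+ D * U = \sum_i constant_coefs (v 0 i) * E i.
  rewrite /U mulr_sumr.
  transitivity (\sum_i (constant_coefs (v 0 i) * E i +
      \sum_j constant_coefs (v 0 i) * (constant_coefs (N i j) * (a j)%:MP))).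
    by apply: eq_bigr => i _; rewrite -mulr_sumr -mulrDr subrK mulrCA.
  rewrite big_split /= [X in _ + X]exchange_big [X in _ + X]big1 ?addr0 //= => j _.
  under eq_bigr do rewrite mulrA -rmorphM; rewrite -mulr_suml -rmorph_sum /=.
  by have /rowP/(_ j) := vN; rewrite !mxE => ->; rewrite rmorph0 mul0r.
have UI : coefs_in (I e) U.
  apply: (generic_form_pow_regular (k := D)) => //; rewrite LU => m.
  rewrite raddf_sum; apply: (ls_sum (sg_ls hI _)) => i _.
  by apply: coefs_in_mul_constant; [exact: sg_ls|exact: hE].
case/eqP: v0; apply/rowP => i; rewrite mxE; apply/mpolyP => m; rewrite mcoeff0.
by apply: (bfree (fun i => (v 0 i)@_m)); rewrite -mcoeff_family; exact: UI.
Qed.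

End GenericLinearForm.

(** * Pulling back along the Veronese embedding *)

Lemma submultinom n (m : 'X_{1..n}) k : (k <= mdeg m)%N ->
  exists2 m' : 'X_{1..n}, (m' <= m)%MM & mdeg m' = k.
Proof.
elim: k => [|k IH] km.
  by exists 0%MM; [apply/mnm_lepP => i; rewrite mnm0E|rewrite mdeg0].
have [m' m'm m'k] := IH (ltnW km).
have [i mi] : exists i, (m' i < m i)%N.
  apply: contrapT => /forallNP h.
  move: km; rewrite -m'k !mdegE ltnNge leq_sum // => i _.
  by rewrite leqNgt; apply/negP/h.
exists (m' + U_(i))%MM; last by rewrite mdegD mdeg1 m'k addn1.
apply/mnm_lepP => j; rewrite mnmDE mnm1E; case: eqP => [<-|_]; first by rewrite addn1.
by rewrite addn0; move/mnm_lepP: m'm; apply.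
Qed.

Section Veronese.
Variables (R : realType) (n d : nat).
Local Notation C := R[i].
Local Notation poly := {mpoly C[n]}.
Local Notation coord_ring := {mpoly C[ncoord n d]}.
Local Notation mon := (nth 0%MM (monomials n d)).

(* By the multinomial formula, the coordinates of [linear_form a ^+ d] are the
   values of these monomials at [a]. *)
Definition veronese_coord : (ncoord n d).-tuple poly :=
  [tuple (d`!%:R / (mfact (mon i))%:R) *: 'X_[mon i] | i < ncoord n d].

Local Notation phi P := (comp_mpoly veronese_coord P).

Lemma veronese_coordE i :
  tnth veronese_coord i = (d`!%:R / (mfact (mon i))%:R) *: 'X_[mon i].
Proof. by rewrite tnth_mktuple. Qed.

Lemma veronese_coord_neq0 (i : 'I_(ncoord n d)) :
  d`!%:R / (mfact (mon i))%:R != 0 :> C.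
Proof.
by rewrite mulf_neq0 ?invr_eq0 ?mfact_neq0 // pnatr_eq0 -lt0n fact_gt0.
Qed.

Lemma phi_homog t (P : coord_ring) : P \is t.-homog -> phi P \is (d * t).-homog.
Proof.
move=> hP; rewrite comp_mpolyEX big_seq; apply: rpred_sum => m mP.
rewrite dhomogZ // comp_mpolyX -(dhomog_mf hP mP) /= mdegE.
elim/big_ind2: _ => [|u a v b hu hv|i _].
- by rewrite muln0 dhomog1.
- by rewrite mulnDr dhomogM.
by rewrite dhomogMn // veronese_coordE dhomogZ // dhomogX /= mdeg_nth_monomials.
Qed.

(** A divisor of degree [d] of the monomial is the image of one coordinate up to a nonzero constant;
    splitting it off lowers [t] by one. *)
Lemma phi_surjX t (m : 'X_{1..n}) : mdeg m = (d * t)%N ->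
  exists2 P : coord_ring, P \is t.-homog & phi P = 'X_[m].
Proof.
elim: t m => [|t IH] m hm.
  exists 1; first exact: dhomog1.
  have /eqP : mdeg m = 0%N by rewrite hm muln0.
  by rewrite mdeg_eq0 => /eqP ->; rewrite rmorph1 mpolyX0.
have dm : (d <= mdeg m)%N by rewrite hm leq_pmulr.
have [m' m'm hm'] := submultinom dm.
have [|P hP eP] := IH (m - m')%MM.
  apply/eqP; rewrite -(eqn_add2r d) -{1}hm' -mdegD submK //.
  by rewrite hm mulnS addnC.
have m'in : m' \in monomials n d by rewrite mem_monomials hm'.
have im' : (index m' (monomials n d) < ncoord n d)%N by rewrite index_mem.
pose i := Ordinal im'; have mi : mon i = m' by rewrite nth_index.
exists ((d`!%:R / (mfact (mon i))%:R)^-1 *: ('X_i * P)).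
  by rewrite dhomogZ // -add1n dhomogM // dhomogX /= mdeg1.
rewrite comp_mpolyZ rmorphM /= comp_mpolyXU eP -tnth_nth veronese_coordE mi.
rewrite -scalerAl scalerA mulVf ?scale1r; last by rewrite -mi veronese_coord_neq0.
by rewrite -mpolyXD addmC submK.
Qed.

Lemma phi_surj t (u : poly) : u \is (d * t).-homog ->
  exists2 P : coord_ring, P \is t.-homog & phi P = u.
Proof.
move=> hu.
have /choice[P hP] : forall m : 'X_{1..n}, exists P : coord_ring,
    mdeg m = (d * t)%N -> P \is t.-homog /\ phi P = 'X_[m].
  move=> m; case: (eqVneq (mdeg m) (d * t)%N) => [hm|hm].
    by have [P hP eP] := phi_surjX hm; exists P.
  by exists 0 => /eqP; rewrite (negbTE hm).
exists (\sum_(m <- msupp u) u@_m *: P m).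
  rewrite big_seq; apply: rpred_sum => m mu; rewrite dhomogZ //.
  by have [] := hP m (dhomog_mf hu mu).
rewrite raddf_sum [RHS]mpolyE big_seq [RHS]big_seq; apply: eq_bigr => m mu /=.
by rewrite comp_mpolyZ; have [_ ->] := hP m (dhomog_mf hu mu).
Qed.

Lemma meval_veronese (a : 'I_n -> C) (P : coord_ring) :
  P.@[coefv d (linear_form a ^+ d) 0] = (phi P).@[a].
Proof.
rewrite comp_mpoly_meval; apply: meval_eq => i.
by rewrite veronese_coordE mevalZ mxE mcoeff_linear_pow // mdeg_nth_monomials.
Qed.

Lemma phi_kernel (J : set coord_ring) t (P : coord_ring) :
  subscheme_of_veronese J -> P \is t.-homog -> phi P = 0 -> J P.
Proof.
move=> hJ hP P0; apply: hJ hP _ => v [ell [hell _] ->].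
by rewrite (dhomog1_linear_form hell) meval_veronese P0 meval0.
Qed.

(** The multinomial factor of each Veronese coordinate cancels the factorial from differentiation.
    So hyperplanes through [f] become operators of degree [d] annihilating [f]. *)
Lemma diffop_phi1 (f : poly) (H : coord_ring) : f \is d.-homog -> H \is 1.-homog ->
  diffop (phi H) f = (d`!%:R * H.@[coefv d f 0])%:MP.
Proof.
move=> hf hH; rewrite (dhomog1_linear_form hH) /linear_form !raddf_sum.
rewrite diffop_suml mulr_sumr raddf_sum; apply: eq_bigr => i _ /=.
rewrite comp_mpolyZ comp_mpolyXU -tnth_nth veronese_coordE mevalZ mevalXU mxE.
rewrite !diffopZl diffopX (mderivm_top hf) ?mdeg_nth_monomials //.
rewrite -!mul_mpolyC -!mpolyCM; congr (_%:MP_[n]).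
rewrite -[_ / _ * _]mulrA [_^-1 * _]mulrCA mulVf ?mfact_neq0 // mulr1.
exact: mulrCA.
Qed.

(* The degree [e] part of the ideal of the subscheme of the projective space
   that the Veronese embedding maps onto the scheme of [J]. *)
Definition veronese_pullback (J : set coord_ring) (e : nat) : set poly :=
  [set p | forall t D (u : poly), (D + e = d * t)%N -> u \is D.-homog ->
     exists2 P : coord_ring, J P /\ P \is t.-homog & phi P = u * p].

(** * The pulled-back ideal: saturation, Hilbert function, apolarity *)

Section Pullback.
Variable J : set coord_ring.
Hypotheses (d_gt0 : (0 < d)%N) (hJ : saturated_hom_ideal J)
           (hV : subscheme_of_veronese J).

Lemma shi_subspace : linear_subspace J.
Proof.
split=> [|p q|c p Jp]; [exact: shi_0|exact: shi_add|].
by rewrite -mul_mpolyC; apply: shi_mul.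
Qed.

Lemma veronese_pullback_subspace e : linear_subspace (veronese_pullback J e).
Proof.
split=> [t D u _ _|p q hp hq t D u hD hu|c p hp t D u hD hu].
- by exists 0; [split; [exact: shi_0|exact: rpred0]|rewrite rmorph0 mulr0].
- have [P [JP hP] eP] := hp t D u hD hu; have [Q [JQ hQ] eQ] := hq t D u hD hu.
  exists (P + Q); first by split; [exact: shi_add|exact: rpredD].
  by rewrite rmorphD /= eP eQ mulrDr.
have [P [JP hP] eP] := hp t D u hD hu.
exists (c *: P); first by split; [exact: (ls_scale shi_subspace)|exact: dhomogZ].
by rewrite comp_mpolyZ eP scalerAr.
Qed.

Lemma veronese_pullback_mul e j u p : u \is j.-homog ->
  veronese_pullback J e p -> veronese_pullback J (j + e)%N (u * p).
Proof.
move=> hu hp t D w hD hw.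
have [||P JP eP] := hp t (D + j)%N (w * u); first by rewrite -addnA.
  exact: dhomogM.
by exists P; rewrite // mulrA.
Qed.

(** Pigeonhole: a monomial of degree above [n * T] is divisible by the [T]-th power of some
    variable. *)
Lemma veronese_pullback_pow e T M p u : (n * T < M)%N -> u \is M.-homog ->
  (forall i, veronese_pullback J (T + e)%N ('X_i ^+ T * p)) ->
  veronese_pullback J (M + e)%N (u * p).
Proof.
move=> nTM hu hp; rewrite (mpolyE u) mulr_suml big_seq.
apply: (ls_sum (veronese_pullback_subspace _)) => m mu.
rewrite -scalerAl; apply: (ls_scale (veronese_pullback_subspace _)).
have mM : mdeg m = M := dhomog_mf hu mu.
have [i Ti] : exists i, (T <= m i)%N.
  apply: contrapT => /forallNP h.
  move: nTM; rewrite -mM mdegE ltnNge => /negP; apply.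
  rewrite -[X in (_ <= X * _)%N]card_ord -sum_nat_const; apply: leq_sum => i _.
  by rewrite ltnW // ltnNge; apply/negP/h.
have Tm : (U_(i) *+ T <= m)%MM.
  apply/mnm_lepP => j; rewrite mulmnE mnm1E.
  by case: eqP => [<-|_]; rewrite ?mul1n ?mul0n.
have TM : (T <= M)%N.
  by rewrite -mM mdegE (bigD1 i) //= (leq_trans Ti) // leq_addr.
rewrite -(submK Tm) mpolyXD -mulrA -mpolyXn -(subnK TM) -addnA.
apply: veronese_pullback_mul (hp i); rewrite dhomogX /=.
apply/eqP/(@addIn T); rewrite subnK // -mM -[in RHS](submK Tm) mdegD mdegMn mdeg1.
by rewrite mul1n.
Qed.

Lemma veronese_pullback_sat e T p : p \is e.-homog ->
  (forall i, veronese_pullback J (T + e)%N ('X_i ^+ T * p)) ->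
  veronese_pullback J e p.
Proof.
move=> hp hTp t D u hD hu.
have hup : u * p \is (d * t).-homog by rewrite -hD dhomogM.
have [P hP eP] := phi_surj hup; exists P => //; split=> //.
(* Saturation of [J] is tested on forms of degree [(n * T).+1], whose images under [phi] have degree
   above [n * T] as [d] is positive. *)
apply: (shi_sat hJ (e := (n * T).+1)) => Y hY.
have hphiY := phi_homog hY.
have nT : (n * T < d * (n * T).+1)%N by rewrite (leq_trans (ltnSn _)) // leq_pmull.
have hDt : (D + (d * (n * T).+1 + e) = d * ((n * T).+1 + t))%N.
  by rewrite addnCA hD mulnDr.
have [Q [JQ hQ] eQ] := veronese_pullback_pow nT hphiY hTp hDt hu.
(* [Q] and [Y * P] have the same image under [phi], so their difference vanishes on the Veronese
   variety and lies in [J]. *)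
have -> : Y * P = Q + (Y * P - Q) by rewrite subrKC.
apply: (shi_add hJ JQ); apply: (phi_kernel (t := ((n * T).+1 + t)%N) hV).
  by rewrite rpredB // dhomogM.
by rewrite rmorphB rmorphM /= eQ eP mulrCA subrr.
Qed.

Lemma veronese_pullback_saturated : saturated_graded (veronese_pullback J).
Proof.
split=> [e|e j u p|e T p].
- exact: veronese_pullback_subspace.
- exact: veronese_pullback_mul.
- exact: veronese_pullback_sat.
Qed.

(** [phi] maps degree [t] onto degree [d * t] and carries [J] into the pullback, so generators go to
    generators. *)
Lemma veronese_pullback_spanned t r (b : r.-tuple coord_ring) :
  quot_basis J t b -> quot_spanned (veronese_pullback J (d * t)) (d * t) r.
Proof.
move=> [hb bspan _]; exists (fun i => phi (tnth b i)) => p hp.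
have [P hP <-] := phi_surj hp; have [c Jc] := bspan P hP; exists c.
set Q := P - _ in Jc; have hQ : Q \is t.-homog.
  by rewrite rpredB //; apply: rpred_sum => i _; rewrite dhomogZ.
have -> : phi P - \sum_i c i *: phi (tnth b i) = phi Q.
  rewrite rmorphB rmorph_sum; congr (_ - _); apply: eq_bigr => i _ /=.
  by rewrite comp_mpolyZ.
move=> t' D u hD hu.
have tt' : (t <= t')%N by rewrite -(leq_pmul2l d_gt0) -hD leq_addl.
have hu' : u \is (d * (t' - t)).-homog by rewrite mulnBr -hD addnK.
have [W hW <-] := phi_surj hu'; exists (W * Q); last by rewrite rmorphM.
by split; [exact: shi_mul|rewrite -(subnK tt') dhomogM].
Qed.

(** Apolarity: for [u] of complementary degree, [u * p] is the image of a hyperplane containing the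
    scheme, hence containing [f], so it annihilates [f]. *)
Lemma veronese_pullback_Ann f e p : f \is d.-homog -> in_span J f ->
  (e <= d)%N -> p \is e.-homog -> veronese_pullback J e p -> Ann f p.
Proof.
move=> hf hspan ed hp Ip; apply: (diffop_eq0 (diffop_homog hf hp)) => u hu.
have [|H [JH hH] eH] := Ip 1%N (d - e)%N u _ hu; first by rewrite subnK // muln1.
by rewrite -diffopM -eH diffop_phi1 // hspan // mulr0 mpolyC0.
Qed.

End Pullback.
End Veronese.

(** * Length of apolar schemes *)

(** All elements are at least [N.+1], so strictness survives the infimum; on the empty set it is
    infinite. *)
Lemma least_gt (R : realType) (X : set nat) N :
  (forall r, X r -> (N < r)%N) -> ((N%:R)%:E < least R X)%E.
Proof.
move=> hX; apply: (@lt_le_trans _ _ (N.+1%:R)%:E); first by rewrite lte_fin ltr_nat.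
by apply: le_ereal_inf_tmp => _ [r /hX Nr <-]; rewrite lee_fin ler_nat.
Qed.

Section CactusRank.
Variables (R : realType) (n d k l s p q : nat).
Local Notation C := R[i].
Local Notation poly := {mpoly C[n]}.
Local Notation constant_coefs := (map_mpoly (@mpolyC n C)).
Variable f : poly.
Hypotheses (hf : f \is d.-homog) (hconcise : k_concise k f)
  (hks : (k <= s)%N) (hsl : (s + l <= d)%N)
  (hunimodal : unimodal d (hilb f)).
Variables (alpha : p.-tuple poly) (beta : q.-tuple poly).
Hypotheses (halpha : quot_basis (Ann f) l alpha)
           (hbeta : quot_basis (Ann f) s beta).

Let m := (d - s - l)%N.

Lemma Ann_hess_kernel_coefs (v : 'rV[poly]_p) : v *m hess f alpha beta = 0 ->
  coefs_in (Ann f) (generic_form R n ^+ m *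
                    \sum_i constant_coefs (v 0 i) * (tnth alpha i)%:MP).
Proof.
move=> vH; apply: coefs_in_Ann => a; rewrite mevalM rmorphXn /= meval_generic_form.
have -> : (\sum_i constant_coefs (v 0 i) * (tnth alpha i)%:MP).@[fun i => (a i)%:MP] =
    \sum_i (v 0 i).@[a] *: tnth alpha i.
  rewrite raddf_sum; apply: eq_bigr => i _ /=.
  by rewrite mevalM meval_constant_coefs mevalC mul_mpolyC.
apply: (Ann_hess_kernel hf hsl halpha hbeta) => j.
have /rowP/(_ j)/(congr1 (meval a)) := vH; rewrite !mxE meval0 => e0.
by rewrite -[RHS]e0 raddf_sum; apply: eq_bigr => i _ /=; rewrite mevalM.
Qed.

Lemma coefs_in_Ann_family0 (v : 'rV[poly]_p) :
  coefs_in (Ann f) (\sum_i constant_coefs (v 0 i) * (tnth alpha i)%:MP) -> v = 0.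
Proof.
case: halpha => _ _ afree hv; apply/rowP => i; rewrite mxE; apply/mpolyP => j.
rewrite mcoeff0; apply: (afree (fun i => (v 0 i)@_j)).
by rewrite -mcoeff_family; exact: hv.
Qed.

(** Otherwise [u] together with a basis modulo [Ann f] would be free modulo the pullback. Its
    [hilb f e + 1] members exceed [r], which bounds the Hilbert function of the pullback. *)
Lemma Ann_sub_pullback (J : set {mpoly C[ncoord n d]}) r e u : (0 < d)%N -> finite_scheme r J ->
  subscheme_of_veronese J -> in_span J f -> (r <= hilb f k)%N ->
  (k <= e)%N -> (e + k <= d)%N -> u \is e.-homog -> Ann f u ->
  veronese_pullback J e u.
Proof.
move=> d0 [hJ [e0 he0]] hV hspan rk ke ekd hu Au.
have hI := veronese_pullback_saturated d0 hJ hV.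
have ed : (e <= d)%N by rewrite (leq_trans _ ekd) // leq_addr.
have [b [hb _ bfree]] := quot_dimP (Ann_subspace f) e.
(* The summand [e0] makes the quotient by [J] have dimension [r] in degree [t]; the summand [e]
   ensures [e <= d * t]. *)
pose c0 := [tuple of u :: b]; pose t := (e0 + e)%N.
have et : (e <= d * t)%N by rewrite (leq_trans (leq_addl e0 e)) // leq_pmull.
apply: contrapT => nIu.
have hc i : tnth c0 i \is e.-homog.
  by case: (unliftP ord0 i) => [j ->|->]; rewrite ?tnthS ?tnth0.
have sub x : x \is e.-homog -> veronese_pullback J e x -> Ann f x.
  exact: (veronese_pullback_Ann hf hspan ed).
have cfree : quot_free (veronese_pullback J e) (tnth c0).
  move=> c Ic; have hs : \sum_i c i *: tnth c0 i \is e.-homog.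
    by apply: rpred_sum => i _; rewrite dhomogZ.
  have := sub _ hs Ic; move: Ic; rewrite !big_ord_recl !tnth0.
  under eq_bigr do rewrite tnthS.
  (* Modulo [Ann f] the term in [u] disappears, so the coefficients on [b] vanish and a multiple of
     [u] is left in the pullback. *)
  move=> Ic /(ls_sub (Ann_subspace f)) /(_ (ls_scale (Ann_subspace f) (c ord0) Au)).
  rewrite addrAC subrr add0r => /(bfree (fun i => c (lift ord0 i))) cb.
  move: Ic; rewrite big1 ?addr0 => [Ic i|j _]; last by rewrite cb scale0r.
  case: (unliftP ord0 i) => [j ->|->]; first exact: cb.
  apply/eqP/negPn/negP => c00; apply: nIu.
  have -> : u = (c ord0)^-1 *: (c ord0 *: u) by rewrite scalerA mulVf // scale1r.
  exact: (ls_scale (sg_ls hI e)).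
have [bJ hbJ] := quot_dimP (shi_subspace hJ) t; rewrite he0 ?leq_addr // in bJ hbJ.
have hspanned := veronese_pullback_spanned d0 hJ hbJ.
rewrite -(subnK et) in hspanned.
have := quot_free_leq_higher hI hspanned hc cfree.
by rewrite ltnNge (leq_trans rk) // (hilb_unimodal_leq hf hunimodal).
Qed.

(** For [f = 0] the quotient is zero, so [alpha] is empty and no rank is below [minn 0 q]. *)
Lemma degenerate_neq0 : degenerate (hess f alpha beta) -> f != 0.
Proof.
move=> hdeg; apply: contraTneq hdeg => f0.
case: p alpha halpha => [|p'] a [_ _ afree].
  by rewrite /degenerate min0n ltn0.
have := afree (fun=> 1) _ ord0; rewrite /Ann /= f0 diffop0r => /(_ erefl) /eqP.
by rewrite oner_eq0.
Qed.

Lemma degenerate_length (J : set {mpoly C[ncoord n d]}) r : degenerate (hess f alpha beta) ->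
  finite_scheme r J -> subscheme_of_veronese J -> in_span J f ->
  (hilb f k < r)%N.
Proof.
move=> hdeg hJ hV hspan; rewrite ltnNge; apply/negP => rk.
have f0 := degenerate_neq0 hdeg.
have [v v0 vH] : exists2 v : 'rV[poly]_p, v != 0 & v *m hess f alpha beta = 0.
  by apply: fraction_mx_kernel; apply: leq_trans hdeg (geq_minl _ _).
pose U := \sum_i constant_coefs (v 0 i) * (tnth alpha i)%:MP.
have LU : coefs_in (Ann f) (generic_form R n ^+ m * U) by exact: Ann_hess_kernel_coefs.
case/eqP: v0; apply: coefs_in_Ann_family0; rewrite -/U.
(* If [d] is 0, then so is [m], and [LU] is already the claim. *)
have [d0|d0] := posnP d; first by move: LU; rewrite /m d0 !sub0n expr0 mul1r.
have hU : coefs_homog l U.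
  move=> j; rewrite mcoeff_family; apply: rpred_sum => i _.
  by rewrite dhomogZ //; case: halpha.
have hI := veronese_pullback_saturated d0 hJ.1 hV.
have ld : (l <= d)%N by rewrite (leq_trans _ hsl) // leq_addl.
suff IU : coefs_in (veronese_pullback J l) U.
  by move=> j; apply: (veronese_pullback_Ann hf hspan ld).
apply: (generic_form_pow_regular (k := m) hI hU) => j.
have ml : (m + l = d - s)%N.
  by rewrite /m subnK // leq_subRL // (leq_trans _ hsl) // leq_addr.
have hLU := generic_form_pow_homog m hU j; rewrite ml in hLU *.
have [kds|dsk] := leqP k (d - s).
  (* The bound [(d - s) + k <= d] comes from [k <= s]. *)
  apply: (Ann_sub_pullback d0 hJ) => //.
  have sd : (s <= d)%N by rewrite (leq_trans _ hsl) // leq_addr.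
  by rewrite -[X in (_ <= X)%N](subnK sd) leq_add2l.
rewrite (Ann_concise_eq0 f0 hconcise (ltnW dsk) hLU) //.
exact: ls_0 (sg_ls hI _).
Qed.

End CactusRank.

Theorem theorem3p14 (R : realType) (n d k l s : nat)
    (f : {mpoly R[i][n.+1]}) (hf : f \is d.-homog)
    (hconcise : k_concise k f) (hkd : (2 * k <= d)%N)
    (hlk : (l <= k)%N) (hks : (k <= s)%N) (hsl : (s + l <= d)%N)
    (hunimodal : unimodal d (hilb f))
    (p q : nat)
    (alpha : p.-tuple {mpoly R[i][n.+1]}) (halpha : quot_basis (Ann f) l alpha)
    (beta : q.-tuple {mpoly R[i][n.+1]}) (hbeta : quot_basis (Ann f) s beta) :
  (degenerate (hess f alpha beta) <->
     generically (fun a : 'I_n.+1 -> R[i] =>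
       ~ mul_pow_injective f (linear_form a) l (d - s - l))) /\
  (degenerate (hess f alpha beta) ->
     ((('C(n + k, k))%:R)%:E < cactus_rank d f)%E /\
     ((border_rank d f <= ((hilb f k)%:R)%:E)%E -> wild d f)).
Proof.
split.
  (* Unimodality and symmetry give [p <= q], so maximal rank means full row rank. *)
  apply: degenerate_generic => //.
  rewrite -(quot_dimE (Ann_subspace f) halpha) -(quot_dimE (Ann_subspace f) hbeta).
  by apply: (hilb_unimodal_leq hf hunimodal) => //; exact: leq_trans hks.
move=> hdeg; have f0 := degenerate_neq0 halpha hdeg.
rewrite -ncoord_bin -(hilb_concise f0 hconcise); split.
  apply: least_gt => r [J [hJ hV hspan]].
  exact: (degenerate_length hf hconcise hks hsl hunimodal halpha hbeta hdeg hJ).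
(* The length bound holds for every finite scheme, so it bounds the smoothable rank too. *)
move=> /le_lt_trans; apply; apply: least_gt => r [J [hJ _ hV hspan]].
exact: (degenerate_length hf hconcise hks hsl hunimodal halpha hbeta hdeg hJ).
Qed.
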